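(* (DMT-optimality for $1>\alpha\ge2/3$ and symmetric rates.) Consider the two-user fading interference channel of the context with $1>\alpha\ge2/3$ and equal multiplexing rates $r_1=r_2=r$, $0\le r\le1$, $\mathbf r=[r\ r]^T$. Then the fixed-power-split HK scheme, whose achievable DMT is $d(\mathbf r)=\max\{d^{HK}(\mathbf r),d^{JD}(\mathbf r)\}$, achieves the optimal DMT of the interference channel: $$\max\{d^{HK}(\mathbf r),d^{JD}(\mathbf r)\}=\max_{\mathbf s}d_1^{ETW}(\mathbf r,\mathbf s).$$ Specifically, the maximum DMT of the scheme is achieved for $r<\alpha/2$ by the joint ML decoder for the interference channel (i.e. $d(\mathbf r)=d^{JD}(\mathbf r)$), and for $r\ge\alpha/2$ by the two-message, fixed-power-split HK scheme with $p_i=1-\alpha$ and $s_i=r-\alpha/2$, $i=1,2$; the outer bound $\max_{\mathbf s}d_1^{ETW}(\mathbf r,\mathbf s)$ is attained at $s_1=s_2=0$ for $r<\alpha/2$ and at $s_1=s_2=r-\alpha/2$ for $r\ge\alpha/2$.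
   Context: **Notation.** Logarithms are to base 2 and $(a)^+=\max(a,0)$. For positive functions $f,g$ of $\mathsf{SNR}$, $f\doteq g$ means $\lim_{\mathsf{SNR}\to\infty}\frac{\log f}{\log\mathsf{SNR}}=\lim_{\mathsf{SNR}\to\infty}\frac{\log g}{\log\mathsf{SNR}}$; $\dot\ge$ is defined analogously. **System model.** Two transmitters $\mathcal T_1,\mathcal T_2$ and two receivers $\mathcal R_1,\mathcal R_2$; over a block of length $N$, $$\mathbf y_1=\sqrt{\mathsf{SNR}}\,h_{11}\mathbf x_1+\sqrt{\mathsf{SNR}^\alpha}\,h_{21}\mathbf x_2+\mathbf z_1,\qquad \mathbf y_2=\sqrt{\mathsf{SNR}^\alpha}\,h_{12}\mathbf x_1+\sqrt{\mathsf{SNR}}\,h_{22}\mathbf x_2+\mathbf z_2,$$ with $\mathbf x_i\in\mathbb C^N$, $\|\mathbf x_i\|^2\le N$, noise $\mathbf z_i\sim\mathcal{CN}(\mathbf 0,\mathbf I_N)$, and scalar fading coefficients $h_{ij}\sim\mathcal{CN}(0,1)$, independent of each other and of the noise, constant over the block. Receivers know their channels $\mathbf h_i=[h_{1i}\ h_{2i}]^T$; transmitters know only the channel statistics; all know $\mathsf{SNR}$ and $\alpha$. $\mathcal T_i$ has rate $r_i\log\mathsf{SNR}$. For a communication scheme $\chi$, $P(E^\chi)$ is the maximum over $i=1,2$ of the channel-averaged probability that $\mathcal R_i$ decodes the message of $\mathcal T_i$ incorrectly, and $d^\chi(\mathbf r)=-\lim_{\mathsf{SNR}\to\infty}\log P(E^\chi)/\log\mathsf{SNR}$.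 **Outer bound exponent.** $\max_{\mathbf s}$ is over $\mathbf s=[s_1\ s_2]^T$ with $0\le s_i\le r_i$, and $d_1^{ETW}(\mathbf r,\mathbf s)=\min_{i=1,2,3,4}d_{1i}^{ETW}(\mathbf r,\mathbf s)$ with $d_{1i}^{ETW}=(1-r_i)^+$ for $i=1,2$; $d_{13}^{ETW}=(1-r_1-r_2+s_2)^++(\alpha-r_1-r_2+s_2)^+$; and, for $\alpha<1$, $d_{14}^{ETW}=(1-\alpha-s_2)^+$ if $s_2>0$, $d_{14}^{ETW}=1$ if $s_2=0$. Every scheme $\chi$ satisfies $d^\chi(\mathbf r)\le\max_{\mathbf s}d_1^{ETW}(\mathbf r,\mathbf s)$ (DMT outer bound). **Joint decoding exponent.** With joint ML detection of both codewords at each receiver (error at $\mathcal R_j$ iff the codeword of $\mathcal T_j$ is wrong), the achievable DMT is $d^{JD}(\mathbf r)=\min\{(1-r_1)^+,(1-r_2)^+,(1-r_1-r_2)^++(\alpha-r_1-r_2)^+\}$. **Two-message fixed-power-split HK scheme.** $\mathcal T_i$ transmits $\mathbf x_i=\mathbf u_i+\mathbf w_i$ ($N\ge2$), private codeword $\mathbf u_i$ at rate $s_i\log\mathsf{SNR}$ with $\|\mathbf u_i\|\le\sqrt{N/\mathsf{SNR}^{1-p_i}}$, public codeword $\mathbf w_i$ at rate $t_i\log\mathsf{SNR}$ with $\|\mathbf w_i\|\le\sqrt N(1-\sqrt{1/\mathsf{SNR}^{1-p_i}})$, $r_i=s_i+t_i$, $s_i,t_i\ge0$, $0\le p_i<1$;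 $\mathcal R_j$ jointly ML-decodes $\mathbf u_j,\mathbf w_j,\mathbf w_i$ ($i\neq j$), with an error iff $\mathbf u_j$ or $\mathbf w_j$ is wrong. Its achievable DMT is $d^{HK}(\mathbf r)=\max_{\mathbf s,\mathbf p}\min_{k=1,2;\,l=1,\dots,6}d_{kl}(\mathbf r,\mathbf s,\mathbf p)$, the maximum being over $0\le s_i\le r_i$, $0\le p_i<1$, where for $i,j\in\{1,2\}$, $i\ne j$: $d_{i1}=(p_i-s_i)^+$ if $p_j<1-\alpha$; $(1-\alpha-p_j+p_i-s_i)^+$ if $p_j\ge 1-\alpha$. $d_{i2}=(1-r_i+s_i)^+$ if $p_j<1-\alpha$; $(2-\alpha-p_j-r_i+s_i)^+$ if $p_j\ge1-\alpha$. $d_{i3}=(1-r_i)^+$ if $p_j<1-\alpha$; $(2-\alpha-p_j-r_i)^+$ if $p_j\ge1-\alpha$. $d_{i4}=(p_i-s_i-r_j+s_j)^++(\alpha-s_i-r_j+s_j)^+$ if $p_j<1-s_i-r_j+s_j$; $(p_i-s_i-r_j+s_j)^+$ if $p_j\ge 1-s_i-r_j+s_j$ and $p_j<1-\alpha$; $(1-\alpha-p_j+p_i-s_i-r_j+s_j)^+$ if $p_j\ge 1-s_i-r_j+s_j$ and $p_j\ge1-\alpha$. $d_{i5}=(1-r_1-r_2+s_1+s_2)^++(\alpha-r_1-r_2+s_1+s_2)^+$ if $p_j<1-r_1-r_2+s_1+s_2$; $(1-r_1-r_2+s_1+s_2)^+$ if $p_j\ge1-r_1-r_2+s_1+s_2$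 and $p_j<1-\alpha$; $(2-\alpha-p_j-r_1-r_2+s_1+s_2)^+$ if $p_j\ge1-r_1-r_2+s_1+s_2$ and $p_j\ge1-\alpha$. $d_{i6}=(1-r_i-r_j+s_j)^++(\alpha-r_i-r_j+s_j)^+$ if $p_j<1-r_i-r_j+s_j$; $(1-r_i-r_j+s_j)^+$ if $p_j\ge1-r_i-r_j+s_j$ and $p_j<1-\alpha$; $(2-\alpha-p_j-r_i-r_j+s_j)^+$ if $p_j\ge1-r_i-r_j+s_j$ and $p_j\ge1-\alpha$. **Fixed-power-split HK scheme (combined).** For given $\mathbf r$ one uses joint decoding if $d^{HK}(\mathbf r)\le d^{JD}(\mathbf r)$ and the two-message scheme otherwise, so that the achievable DMT is $d(\mathbf r)=\max\{d^{HK}(\mathbf r),d^{JD}(\mathbf r)\}$. *)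

(* Defs.v *)
From HB Require Import structures.
From mathcomp Require Import all_boot all_order all_algebra.
From mathcomp Require Import all_classical all_reals all_analysis.
From mathcomp Require Import complex.
Set Implicit Arguments.
Unset Strict Implicit.
Unset Printing Implicit Defensive.
Import Order.TTheory GRing.Theory Num.Theory.
Import numFieldNormedType.Exports.
Local Open Scope classical_set_scope.
Local Open Scope ring_scope.

(* Users are indexed by 'I_2; ord0 is user 1 and ord_max is user 2. Pairs     *)
(* such as (r_1, r_2) are functions 'I_2 -> R.                                *)

Definition other (i : 'I_2) : 'I_2 := rev_ord i.

Definition pos_part (R : realType) (a : R) : R := Num.max a 0.

Definition rate_split (R : realType) (r s : 'I_2 -> R) : Prop :=
  forall i, 0 <= s i <= r i.

Definition power_split (R : realType) (p : 'I_2 -> R) : Prop :=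
  forall i, 0 <= p i < 1.

(* The value of d_{14}^{ETW} is only meaningful for alpha < 1.                *)
Definition d1_ETW (R : realType) (alpha : R) (r s : 'I_2 -> R) : R :=
  let r1 := r ord0 in let r2 := r ord_max in let s2 := s ord_max in
  let d11 := pos_part (1 - r1) in
  let d12 := pos_part (1 - r2) in
  let d13 := pos_part (1 - r1 - r2 + s2) + pos_part (alpha - r1 - r2 + s2) in
  let d14 := if 0 < s2 then pos_part (1 - alpha - s2) else 1 in
  Num.min (Num.min d11 d12) (Num.min d13 d14).

Definition d_outer (R : realType) (alpha : R) (r : 'I_2 -> R) : R :=
  sup [set d1_ETW alpha r s | s in rate_split r].

Definition d_JD (R : realType) (alpha : R) (r : 'I_2 -> R) : R :=
  let r1 := r ord0 in let r2 := r ord_max in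
  Num.min (Num.min (pos_part (1 - r1)) (pos_part (1 - r2)))
    (pos_part (1 - r1 - r2) + pos_part (alpha - r1 - r2)).

Definition d_HK1 (R : realType) (alpha : R) (r s p : 'I_2 -> R) (i : 'I_2) : R :=
  let j := other i in
  if p j < 1 - alpha then pos_part (p i - s i)
  else pos_part (1 - alpha - p j + p i - s i).

Definition d_HK2 (R : realType) (alpha : R) (r s p : 'I_2 -> R) (i : 'I_2) : R :=
  let j := other i in
  if p j < 1 - alpha then pos_part (1 - r i + s i)
  else pos_part (2 - alpha - p j - r i + s i).

Definition d_HK3 (R : realType) (alpha : R) (r s p : 'I_2 -> R) (i : 'I_2) : R :=
  let j := other i in
  if p j < 1 - alpha then pos_part (1 - r i)
  else pos_part (2 - alpha - p j - r i).

Definition d_HK4 (R : realType) (alpha : R) (r s p : 'I_2 -> R) (i : 'I_2) : R :=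
  let j := other i in
  if p j < 1 - s i - r j + s j then
    pos_part (p i - s i - r j + s j) + pos_part (alpha - s i - r j + s j)
  else if p j < 1 - alpha then pos_part (p i - s i - r j + s j)
  else pos_part (1 - alpha - p j + p i - s i - r j + s j).

Definition d_HK5 (R : realType) (alpha : R) (r s p : 'I_2 -> R) (i : 'I_2) : R :=
  let j := other i in
  if p j < 1 - r i - r j + s i + s j then
    pos_part (1 - r i - r j + s i + s j)
    + pos_part (alpha - r i - r j + s i + s j)
  else if p j < 1 - alpha then pos_part (1 - r i - r j + s i + s j)
  else pos_part (2 - alpha - p j - r i - r j + s i + s j).

Definition d_HK6 (R : realType) (alpha : R) (r s p : 'I_2 -> R) (i : 'I_2) : R :=
  let j := other i in
  if p j < 1 - r i - r j + s j then
    pos_part (1 - r i - r j + s j) + pos_part (alpha - r i - r j + s j)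
  else if p j < 1 - alpha then pos_part (1 - r i - r j + s j)
  else pos_part (2 - alpha - p j - r i - r j + s j).

Definition d_HK_rx (R : realType) (alpha : R) (r s p : 'I_2 -> R) (i : 'I_2) : R :=
  Num.min
    (Num.min (Num.min (d_HK1 alpha r s p i) (d_HK2 alpha r s p i))
             (Num.min (d_HK3 alpha r s p i) (d_HK4 alpha r s p i)))
    (Num.min (d_HK5 alpha r s p i) (d_HK6 alpha r s p i)).

Definition d_HK_at (R : realType) (alpha : R) (r s p : 'I_2 -> R) : R :=
  Num.min (d_HK_rx alpha r s p ord0) (d_HK_rx alpha r s p ord_max).

(* The range of p is not closed and the exponents jump, so the maximum over   *)
(* (s, p) is taken as a supremum.                                             *)
Definition d_HK (R : realType) (alpha : R) (r : 'I_2 -> R) : R :=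
  sup [set d | exists s p,
         [/\ rate_split r s, power_split p & d = d_HK_at alpha r s p]].

Definition d_FPS (R : realType) (alpha : R) (r : 'I_2 -> R) : R :=
  Num.max (d_HK alpha r) (d_JD alpha r).

Definition sqnorm (R : realType) (n : nat) (v : 'cV[R[i]]_n) : R :=
  \sum_k (complex.Re (v k 0) ^+ 2 + complex.Im (v k 0) ^+ 2).

Definition gain (R : realType) (alpha snr : R) (i j : 'I_2) : R :=
  Num.sqrt (if i == j then snr else snr `^ alpha).

(* Noiseless output at receiver j when transmitter j sends x and the other    *)
(* one sends x'. The i-th entry of h is h_{ij}.                               *)
Definition rx_mean (R : realType) (N : nat) (alpha snr : R) (j : 'I_2)
    (h : 'cV[R[i]]_2) (x x' : 'cV[R[i]]_N) : 'cV[R[i]]_N :=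
  (real_complex R (gain alpha snr j j) * h j 0) *: x
  + (real_complex R (gain alpha snr (other j) j) * h (other j) 0) *: x'.

(* Density at y of CN(mu, I_N).                                               *)
Definition likelihood (R : realType) (N : nat) (y mu : 'cV[R[i]]_N) : R :=
  pi ^- N * expR (- sqnorm (y - mu)).

Definition mutually_independent (R : realType) (d : measure_display)
    (Omega : measurableType d) (P : probability Omega R) (I : finType)
    (X : I -> {RV P >-> R}) : Prop :=
  forall A : I -> set R, (forall k, measurable (A k)) ->
    fine (P (\bigcap_k (X k @^-1` A k))) = \prod_k fine (P (X k @^-1` A k)).

(* Indices of the real and imaginary parts (flags false and true) of h_{ij}   *)
(* and of the k-th noise sample at receiver j.                                *)
Definition source (N : nat) : finType :=
  (('I_2 * 'I_2 + 'I_2 * 'I_N) * bool)%type.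

(* CN(0,1) has independent real and imaginary parts of variance 1/2;          *)
(* normal_prob takes the standard deviation.                                  *)
Definition gaussian_sources (R : realType) (d : measure_display)
    (Omega : measurableType d) (P : probability Omega R) (N : nat)
    (G : source N -> {RV P >-> R}) : Prop :=
  mutually_independent G /\
  forall k (A : set R), measurable A ->
    P (G k @^-1` A) = normal_prob 0 (Num.sqrt 2^-1) A.

Definition fading (R : realType) (d : measure_display)
    (Omega : measurableType d) (P : probability Omega R) (N : nat)
    (G : source N -> {RV P >-> R}) (j : 'I_2) (w : Omega) : 'cV[R[i]]_2 :=
  \col_i Complex (G (inl (i, j), false) w) (G (inl (i, j), true) w).

Definition noise (R : realType) (d : measure_display)
    (Omega : measurableType d) (P : probability Omega R) (N : nat)
    (G : source N -> {RV P >-> R}) (j : 'I_2) (w : Omega) : 'cV[R[i]]_N :=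
  \col_k Complex (G (inr (j, k), false) w) (G (inr (j, k), true) w).

(* A scheme fixes, for each SNR, message sets, codebooks and decoders. The    *)
(* encoders see no channel coefficient; the decoder of receiver j sees only   *)
(* (h_{1j}, h_{2j}) and its own output.                                       *)
Record scheme (R : realType) (N : nat) := Scheme {
  msg : R -> 'I_2 -> finType;
  enc : forall (snr : R) (i : 'I_2), msg snr i -> 'cV[R[i]]_N;
  dec : forall (snr : R) (j : 'I_2),
    'cV[R[i]]_2 -> 'cV[R[i]]_N -> msg snr j }.

Definition obs_coord (R : realType) (N : nat) (k : ('I_2 + 'I_N) * bool)
    (o : 'cV[R[i]]_2 * 'cV[R[i]]_N) : R :=
  let z := match k.1 with inl i => o.1 i 0 | inr t => o.2 t 0 end in
  if k.2 then complex.Im z else complex.Re z.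

(* Borel sets of C^2 x C^N, generated by the real coordinates.                *)
Definition borel_obs (R : realType) (N : nat) :
    set (set ('cV[R[i]]_2 * 'cV[R[i]]_N)) :=
  <<s [set B | exists k (A : set R),
         measurable A /\ B = @obs_coord R N k @^-1` A] >>.

(* size snr is about SNR^(N rho), i.e. a rate of rho log SNR per channel use. *)
Definition multiplexing_rate (R : realType) (N : nat) (size : R -> nat)
    (rho : R) : Prop :=
  ln (size snr)%:R / (N%:R * ln snr) @[snr --> +oo] --> rho.

(* At least two messages are required so that decoding is not void when a     *)
(* multiplexing rate is zero.                                                 *)
Definition valid_scheme (R : realType) (N : nat) (r : 'I_2 -> R)
    (X : scheme R N) : Prop :=
  [/\ forall snr i, 1 < snr -> (1 < #|msg X snr i|)%N,
      forall i, multiplexing_rate N (fun snr => #|msg X snr i|) (r i),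
      forall snr i (m : msg X snr i), 1 < snr -> sqnorm (enc m) <= N%:R
    & forall snr j (m : msg X snr j), 1 < snr ->
        borel_obs [set o | dec X snr j o.1 o.2 = m]].

Definition rx_output (R : realType) (d : measure_display)
    (Omega : measurableType d) (P : probability Omega R) (N : nat)
    (G : source N -> {RV P >-> R}) (alpha : R) (X : scheme R N) (snr : R)
    (m : {dffun forall i : 'I_2, msg X snr i}) (j : 'I_2) (w : Omega) :
    'cV[R[i]]_N :=
  rx_mean alpha snr j (fading G j w) (enc (m j)) (enc (m (other j)))
  + noise G j w.

(* Messages are uniform and independent of the channel and of each other.     *)
Definition error_prob_rx (R : realType) (d : measure_display)
    (Omega : measurableType d) (P : probability Omega R) (N : nat)
    (G : source N -> {RV P >-> R}) (alpha : R) (X : scheme R N) (snr : R)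
    (j : 'I_2) : \bar R :=
  ((#|{dffun forall i : 'I_2, msg X snr i}|%:R^-1)%:E *
   \sum_(m : {dffun forall i : 'I_2, msg X snr i})
     P [set w | dec X snr j (fading G j w) (rx_output G alpha m j w) <> m j])%E.

Definition error_prob (R : realType) (d : measure_display)
    (Omega : measurableType d) (P : probability Omega R) (N : nat)
    (G : source N -> {RV P >-> R}) (alpha : R) (X : scheme R N) (snr : R) :
    \bar R :=
  maxe (error_prob_rx G alpha X snr ord0) (error_prob_rx G alpha X snr ord_max).

(* The ratio of logarithms does not depend on their base. It is +oo when the  *)
(* error probability vanishes.                                                *)
Definition has_dmt (R : realType) (d : measure_display)
    (Omega : measurableType d) (P : probability Omega R) (N : nat)
    (G : source N -> {RV P >-> R}) (alpha : R) (X : scheme R N) (e : \bar R) :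
    Prop :=
  (- (lne (error_prob G alpha X snr) * ((ln snr)^-1)%:E))%E
    @[snr --> +oo] --> e.

Definition optimal_dmt (R : realType) (d : measure_display)
    (Omega : measurableType d) (P : probability Omega R) (N : nat)
    (G : source N -> {RV P >-> R}) (alpha : R) (r : 'I_2 -> R) (e : \bar R) :
    Prop :=
  (exists2 X : scheme R N, valid_scheme r X & has_dmt G alpha X e) /\
  (forall (X : scheme R N) e',
     valid_scheme r X -> has_dmt G alpha X e' -> (e' <= e)%E).

(* Both receivers detect the pair of messages by maximum likelihood and keep  *)
(* the component intended for them.                                           *)
Definition joint_ML (R : realType) (N : nat) (alpha : R) (X : scheme R N) :
    Prop :=
  exists jdec : forall (snr : R) (j : 'I_2), 'cV[R[i]]_2 -> 'cV[R[i]]_N ->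
      {dffun forall i : 'I_2, msg X snr i},
    forall snr j h y, 1 < snr ->
      let mean (m : {dffun forall i : 'I_2, msg X snr i}) :=
        rx_mean alpha snr j h (enc (m j)) (enc (m (other j))) in
      dec X snr j h y = jdec snr j h y j /\
      forall m, likelihood y (mean m) <= likelihood y (mean (jdec snr j h y)).

(* Two-message code: ucode and wcode are the private and public codebooks;    *)
(* hkdec snr j h y estimates (private of j, public of j, public of the other).*)
Record hk_code (R : realType) (N : nat) := HKCode {
  priv : R -> 'I_2 -> finType;
  pub : R -> 'I_2 -> finType;
  ucode : forall (snr : R) (i : 'I_2), priv snr i -> 'cV[R[i]]_N;
  wcode : forall (snr : R) (i : 'I_2), pub snr i -> 'cV[R[i]]_N;
  hkdec : forall (snr : R) (j : 'I_2), 'cV[R[i]]_2 -> 'cV[R[i]]_N ->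
    priv snr j * pub snr j * pub snr (other j) }.

Definition hk_scheme (R : realType) (N : nat) (c : hk_code R N) : scheme R N :=
  @Scheme R N
    (fun snr i => (priv c snr i * pub c snr i)%type)
    (fun snr i m => ucode m.1 + wcode m.2)
    (fun snr j h y => (hkdec c snr j h y).1).

(* Likelihood of (u_j, w_j, w_i) at receiver j; the private message of the    *)
(* other user is not decoded and is averaged out.                             *)
Definition hk_likelihood (R : realType) (N : nat) (alpha : R)
    (c : hk_code R N) (snr : R) (j : 'I_2) (h : 'cV[R[i]]_2)
    (y : 'cV[R[i]]_N)
    (a : priv c snr j * pub c snr j * pub c snr (other j)) : R :=
  #|priv c snr (other j)|%:R^-1 *
  \sum_(b : priv c snr (other j))
    likelihood y (rx_mean alpha snr j h
                    (ucode a.1.1 + wcode a.1.2) (ucode b + wcode a.2)).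

Definition is_hk (R : realType) (N : nat) (alpha : R) (r s p : 'I_2 -> R)
    (c : hk_code R N) : Prop :=
  [/\ valid_scheme r (hk_scheme c),
      forall i, multiplexing_rate N (fun snr => #|priv c snr i|) (s i) /\
                multiplexing_rate N (fun snr => #|pub c snr i|) (r i - s i),
      forall snr i (m : priv c snr i), 1 < snr ->
        Num.sqrt (sqnorm (ucode m)) <= Num.sqrt (N%:R / snr `^ (1 - p i)),
      forall snr i (m : pub c snr i), 1 < snr ->
        Num.sqrt (sqnorm (wcode m)) <=
          Num.sqrt N%:R * (1 - Num.sqrt (1 / snr `^ (1 - p i)))
    & forall snr j h y (a : priv c snr j * pub c snr j * pub c snr (other j)),
        1 < snr ->
        hk_likelihood alpha h y a
          <= hk_likelihood alpha h y (hkdec c snr j h y)].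

Definition FPS_scheme (R : realType) (N : nat) (alpha : R) (r : 'I_2 -> R)
    (X : scheme R N) : Prop :=
  if d_HK alpha r <= d_JD alpha r then
    valid_scheme r X /\ joint_ML alpha X
  else
    exists s p (c : hk_code R N),
      [/\ rate_split r s, power_split p,
          d_HK_at alpha r s p = d_HK alpha r,
          is_hk alpha r s p c & X = hk_scheme c].

(* Main.v *)
(** At a receiver [i] whose user has the smaller power exponent [p i], the
    private-message exponent [d_HK1] is at most (1 - alpha - s_i)^+, while
    [d_HK6] at the other receiver is at most
    (1 - r_1 - r_2 + s_i)^+ + (alpha - r_1 - r_2 + s_i)^+. So the two-message
    exponent obeys the bound defining the ETW outer bound, with the private
    rate s_i in the role of s_2. For r >= alpha/2 the minimum of these
    two expressions is at most (1 - alpha/2 - r)^+, with equality where they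
    cross, at s_i = r - alpha/2; for r < alpha/2 the bound 1 - alpha on the
    first is already dominated by joint decoding. *)
Require Import Defs.
From mathcomp Require Import all_boot all_order all_algebra.
From mathcomp Require Import all_classical all_reals all_analysis.
From mathcomp Require Import lra.
Set Implicit Arguments.
Unset Strict Implicit.
Unset Printing Implicit Defensive.
Import Order.TTheory GRing.Theory Num.Theory.
Local Open Scope classical_set_scope.
Local Open Scope ring_scope.

(** * Positive parts and attained suprema *)

Lemma pos_partP (R : realType) (x : R) :
  0 <= x /\ pos_part x = x \/ x <= 0 /\ pos_part x = 0.
Proof.
rewrite /pos_part; case: (leP x 0) => h; first by right.
by left; split=> //; exact: ltW.
Qed.

(** Splitting each positive part by the sign of its argument leaves purely linear goals. *)
Ltac pos_part_lra :=
  repeat match goal with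
  | |- context [pos_part ?x] =>
      let e := fresh in case: (pos_partP x) => -[? e]; rewrite ?{}e
  end; intros; lra.

(** Reduces each claim about an optimum to a witness and a matching upper bound, so that the suprema
    are genuine maxima. *)
Lemma sup_attained (R : realType) (S : set R) (x : R) :
  S x -> ubound S x -> sup S = x.
Proof.
move=> Sx ubx; apply/le_anti/andP; split.
  by apply: ge_sup => //; exists x.
by apply: ub_le_sup => //; exists x.
Qed.

Lemma otherK : involutive other.
Proof. exact: rev_ordK. Qed.

(** * Upper bounds on the two-message exponents, for arbitrary rates *)

Section HanKobayashi.
Variables (R : realType) (alpha : R).
Implicit Types (r s p : 'I_2 -> R) (i : 'I_2).

Lemma d_HK_at_le_rx r s p i : d_HK_at alpha r s p <= d_HK_rx alpha r s p i.
Proof.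
rewrite /d_HK_at ge_min.
have [->|->] : i = ord0 \/ i = ord_max.
  by case: i => -[|[|//]] ?; [left|right]; exact: val_inj.
- by rewrite lexx.
- by rewrite lexx orbT.
Qed.

(** Below the threshold, p_i <= p_j < 1 - alpha; above it, the loss p_j outweighs the gain p_i. *)
Lemma d_HK1_le r s p i : p i <= p (other i) ->
  d_HK1 alpha r s p i <= pos_part (1 - alpha - s i).
Proof. by move=> hp; rewrite /d_HK1; case: ltP => h; pos_part_lra. Qed.

(** In the last two branches the exponent is at most the first positive part alone: the power p_i >=
    1 - alpha can only lower it. *)
Lemma d_HK6_le r s p i :
  d_HK6 alpha r s p (other i) <=
    pos_part (1 - r (other i) - r i + s i)
    + pos_part (alpha - r (other i) - r i + s i).
Proof.
rewrite /d_HK6 otherK.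
by case: ltP => _; [exact: lexx|case: ltP => h; pos_part_lra].
Qed.

Lemma d_HK_at_le r s p : exists i,
  d_HK_at alpha r s p <= pos_part (1 - alpha - s i) /\
  d_HK_at alpha r s p <= pos_part (1 - r (other i) - r i + s i)
                         + pos_part (alpha - r (other i) - r i + s i).
Proof.
have [i hi] : exists i, p i <= p (other i).
  case: (leP (p ord0) (p (other ord0))) => [|/ltW] h; first by exists ord0.
  by exists (other ord0); rewrite otherK.
exists i; split.
- apply: le_trans (d_HK1_le r s hi); apply: le_trans (d_HK_at_le_rx _ _ _ i) _.
  by rewrite /d_HK_rx !ge_min lexx.
- apply: le_trans (d_HK6_le r s p i).
  apply: le_trans (d_HK_at_le_rx _ _ _ (other i)) _.
  by rewrite /d_HK_rx !ge_min lexx !orbT.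
Qed.

End HanKobayashi.

(** * Symmetric rates: bounds and optimal splits *)

Section SymmetricRates.
Variables (R : realType) (alpha r : R).
Hypotheses (alpha_ge : 2 / 3 <= alpha) (alpha_lt1 : alpha < 1).
Hypotheses (r_ge0 : 0 <= r) (r_le1 : r <= 1).
Implicit Types (s p : 'I_2 -> R).

Let rr := fun _ : 'I_2 => r.
Let s0 := fun _ : 'I_2 => 0 : R.
Let s1 := fun _ : 'I_2 => r - alpha / 2.
Let p1 := fun _ : 'I_2 => 1 - alpha.

Ltac range_lra :=
  move: alpha_ge alpha_lt1 r_ge0 r_le1 => ? ? ? ?; pos_part_lra.

(** The first bound decreases in x and the second increases; they meet at x = r - alpha/2, where
    alpha - 2r + x = alpha/2 - r <= 0 contributes nothing. *)
Lemma min_exponents_le (x d : R) : alpha / 2 <= r ->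
  d <= pos_part (1 - alpha - x) ->
  d <= pos_part (1 - r - r + x) + pos_part (alpha - r - r + x) ->
  d <= pos_part (1 - alpha / 2 - r).
Proof. by move=> h; range_lra. Qed.

Lemma rate_split_s0 : rate_split rr s0.
Proof. by move=> i; rewrite /s0 /rr lexx r_ge0. Qed.

Lemma rate_split_s1 : alpha / 2 <= r -> rate_split rr s1.
Proof. by move=> h i; apply/andP; split; rewrite /s1 /rr /=; range_lra. Qed.

Lemma power_split_p1 : power_split p1.
Proof.
by move: alpha_ge alpha_lt1 => ? ? i; apply/andP; split; rewrite /p1; lra.
Qed.

(** Here 1 - r >= 1 - 2r > 1 - alpha. The level 1 - alpha caps the two-message exponent and the
    outer bound with s_2 > 0. *)
Lemma d_JD_ge : r < alpha / 2 -> 1 - alpha <= d_JD alpha rr.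
Proof.
by move=> h; rewrite /d_JD /rr !le_min -andbA; apply/and3P; split; range_lra.
Qed.

Lemma d_JD_le : alpha / 2 <= r -> d_JD alpha rr <= pos_part (1 - alpha / 2 - r).
Proof.
move=> h; rewrite /d_JD /rr ge_min; apply/orP; right.
by range_lra.
Qed.

Lemma d_HK_at_le_JD s p : rate_split rr s -> r < alpha / 2 ->
  d_HK_at alpha rr s p <= d_JD alpha rr.
Proof.
move=> hs h; have [i [hi _]] := d_HK_at_le alpha rr s p.
apply: le_trans hi (le_trans _ (d_JD_ge h)).
by have /andP[? _] := hs i; range_lra.
Qed.

Lemma d_HK_at_le_large s p : alpha / 2 <= r ->
  d_HK_at alpha rr s p <= pos_part (1 - alpha / 2 - r).
Proof.
move=> h; have [i [h1 h6]] := d_HK_at_le alpha rr s p.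
exact: min_exponents_le h1 h6.
Qed.

(** A positive s_2 caps the fourth exponent at 1 - alpha, which joint decoding reaches; s_2 = 0
    leaves the joint-decoding terms in the minimum. *)
Lemma d1_ETW_le_JD s : rate_split rr s -> r < alpha / 2 ->
  d1_ETW alpha rr s <= d_JD alpha rr.
Proof.
move=> hs h; rewrite /d1_ETW; case: ltP => s2.
  apply: le_trans (d_JD_ge h); rewrite !ge_min.
  by apply/orP; right; apply/orP; right; range_lra.
have s2_0 : s ord_max = 0.
  by apply/le_anti; rewrite s2; have /andP[->] := hs ord_max.
by rewrite s2_0 /d_JD /rr !addr0 minA ge_min lexx.
Qed.

Lemma d1_ETW_le_large s : rate_split rr s -> alpha / 2 <= r ->
  d1_ETW alpha rr s <= pos_part (1 - alpha / 2 - r).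
Proof.
move=> hs h; rewrite /d1_ETW; case: ltP => s2.
  apply: (@min_exponents_le (s ord_max)) => //.
    by rewrite !ge_min lexx !orbT.
  by rewrite !ge_min lexx !orbT.
have s2_0 : s ord_max = 0.
  by apply/le_anti; rewrite s2; have /andP[->] := hs ord_max.
(* The third exponent suffices: alpha - 2r <= 0 and 1 - 2r <= 1 - alpha/2 - r. *)
rewrite !ge_min s2_0; apply/orP; right; apply/orP; left.
by rewrite /rr; range_lra.
Qed.

(** The fourth exponent takes its special value 1 at s_2 = 0, and 1 - r <= 1 makes it redundant in
    the minimum. *)
Lemma d1_ETW_s0 : r < alpha / 2 -> d1_ETW alpha rr s0 = d_JD alpha rr.
Proof.
move=> h; rewrite /d1_ETW /d_JD /s0 /rr ltxx !addr0 minA.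
by apply: min_l; rewrite !ge_min; apply/orP; left; apply/orP; left; range_lra.
Qed.

Lemma d1_ETW_s1 : alpha / 2 <= r ->
  d1_ETW alpha rr s1 = pos_part (1 - alpha / 2 - r).
Proof.
move=> h; apply/le_anti; rewrite d1_ETW_le_large //=; last exact: rate_split_s1.
rewrite /d1_ETW /rr /s1 !le_min.
by apply/andP; split; apply/andP; split; last (case: ltP => ?); range_lra.
Qed.

Lemma d_HK_at_s1_p1 : alpha / 2 <= r ->
  d_HK_at alpha rr s1 p1 = pos_part (1 - alpha / 2 - r).
Proof.
move=> h; apply/le_anti; rewrite d_HK_at_le_large //=.
suff rx i : pos_part (1 - alpha / 2 - r) <= d_HK_rx alpha rr s1 p1 i.
  by rewrite /d_HK_at le_min !rx.
rewrite /d_HK_rx !le_min.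
(* The powers sit exactly at the threshold 1 - alpha, so every strict test against it fails. *)
rewrite /d_HK1 /d_HK2 /d_HK3 /d_HK4 /d_HK5 /d_HK6 /rr /s1 /p1 !ltxx /=.
(* Exponents 1 and 6 are tight. Exponent 4 relies on alpha >= 2/3: for r < alpha it is at least
   alpha - r >= 1 - alpha/2 - r, and for r >= alpha the target is 0. *)
by do ![apply/andP; split]; try (case: ifPn; rewrite -?leNgt => ?); range_lra.
Qed.

(** * Values of the optima in the two rate regimes *)

Lemma d_outer_small : r < alpha / 2 -> d_outer alpha rr = d_JD alpha rr.
Proof.
move=> h; apply: sup_attained.
  by exists s0; [exact: rate_split_s0|exact: d1_ETW_s0].
by move=> _ [s hs <-]; exact: d1_ETW_le_JD.
Qed.

Lemma d_outer_large : alpha / 2 <= r ->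
  d_outer alpha rr = pos_part (1 - alpha / 2 - r).
Proof.
move=> h; apply: sup_attained.
  by exists s1; [exact: rate_split_s1|exact: d1_ETW_s1].
by move=> _ [s hs <-]; exact: d1_ETW_le_large.
Qed.

Lemma d_HK_small : r < alpha / 2 -> d_HK alpha rr <= d_JD alpha rr.
Proof.
move=> h; apply: ge_sup.
  (* This witness only shows that the set is nonempty. *)
  exists (d_HK_at alpha rr s0 p1), s0, p1.
  by split=> //; [exact: rate_split_s0|exact: power_split_p1].
by move=> _ [s [p [hs _ ->]]]; exact: d_HK_at_le_JD.
Qed.

Lemma d_HK_large : alpha / 2 <= r ->
  d_HK alpha rr = pos_part (1 - alpha / 2 - r).
Proof.
move=> h; apply: sup_attained.
  exists s1, p1; rewrite d_HK_at_s1_p1 //.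
  by split=> //; [exact: rate_split_s1|exact: power_split_p1].
by move=> _ [s [p [_ _ ->]]]; exact: d_HK_at_le_large.
Qed.

Lemma d_FPS_small : r < alpha / 2 -> d_FPS alpha rr = d_JD alpha rr.
Proof. by move=> h; apply: max_r; exact: d_HK_small. Qed.

Lemma d_FPS_large : alpha / 2 <= r -> d_FPS alpha rr = d_HK alpha rr.
Proof. by move=> h; apply: max_l; rewrite d_HK_large // d_JD_le. Qed.

Lemma d_FPS_eq_outer : d_FPS alpha rr = d_outer alpha rr.
Proof.
case: (ltP r (alpha / 2)) => h; first by rewrite d_FPS_small // d_outer_small.
by rewrite d_FPS_large // d_HK_large // d_outer_large.
Qed.

End SymmetricRates.

(** * From exponents to coding schemes *)

Theorem mainTheorem5 (R : realType) (alpha r : R)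
    (alpha_range : 2 / 3 <= alpha < 1) (r_range : 0 <= r <= 1) :
  let rr := fun _ : 'I_2 => r in
  let s0 := fun _ : 'I_2 => 0 : R in
  let s1 := fun _ : 'I_2 => r - alpha / 2 in
  let p1 := fun _ : 'I_2 => 1 - alpha in
  [/\ Num.max (d_HK alpha rr) (d_JD alpha rr) = d_outer alpha rr,
      r < alpha / 2 ->
        [/\ d_FPS alpha rr = d_JD alpha rr,
            rate_split rr s0
          & d1_ETW alpha rr s0 = d_outer alpha rr],
      alpha / 2 <= r ->
        [/\ rate_split rr s1, power_split p1,
            d_FPS alpha rr = d_HK_at alpha rr s1 p1,
            d_HK alpha rr = d_HK_at alpha rr s1 p1
          & d1_ETW alpha rr s1 = d_outer alpha rr]
    & forall (N : nat) (d : measure_display) (Omega : measurableType d)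
        (P : probability Omega R) (G : source N -> {RV P >-> R}),
      (2 <= N)%N -> gaussian_sources G ->
      (* the known outer bound and achievability results for this channel *)
      (forall (X : scheme R N) (e : \bar R),
         valid_scheme rr X -> has_dmt G alpha X e ->
         (e <= (d_outer alpha rr)%:E)%E) ->
      (exists (X : scheme R N) (e : \bar R),
         [/\ valid_scheme rr X, joint_ML alpha X, has_dmt G alpha X e
           & ((d_JD alpha rr)%:E <= e)%E]) ->
      (forall s p : 'I_2 -> R, rate_split rr s -> power_split p ->
         exists (c : hk_code R N) (e : \bar R),
         [/\ is_hk alpha rr s p c, has_dmt G alpha (hk_scheme c) e
           & ((d_HK_at alpha rr s p)%:E <= e)%E]) ->
      [/\ optimal_dmt G alpha rr (d_FPS alpha rr)%:E,
          exists2 X : scheme R N, FPS_scheme alpha rr X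
            & has_dmt G alpha X (d_FPS alpha rr)%:E,
          r < alpha / 2 -> exists X : scheme R N,
            [/\ valid_scheme rr X, joint_ML alpha X
              & has_dmt G alpha X (d_FPS alpha rr)%:E]
        & alpha / 2 <= r -> exists2 c : hk_code R N,
            is_hk alpha rr s1 p1 c
            & has_dmt G alpha (hk_scheme c) (d_FPS alpha rr)%:E]].
Proof.
case/andP: alpha_range => a23 a1; case/andP: r_range => r0 r1.
move=> rr s0 s1 p1.
have FPS_outer : d_FPS alpha rr = d_outer alpha rr by exact: d_FPS_eq_outer.
split.
- exact: FPS_outer.
- move=> h; split; first exact: d_FPS_small.
    exact: rate_split_s0.
  by rewrite d_outer_small //; exact: d1_ETW_s0.
- move=> h; split; first exact: rate_split_s1.
  + exact: power_split_p1.
  + by rewrite d_FPS_large // d_HK_large // d_HK_at_s1_p1.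
  + by rewrite d_HK_large // d_HK_at_s1_p1.
  + by rewrite d_outer_large // d1_ETW_s1.
move=> N d Omega P G _ _ outer JD HK.
(* The converse turns an achieved lower bound into an exact DMT, since the target equals the outer
   bound. *)
have tight X e : valid_scheme rr X -> has_dmt G alpha X e ->
    ((d_FPS alpha rr)%:E <= e)%E -> has_dmt G alpha X (d_FPS alpha rr)%:E.
  move=> vX hX le_e; suff -> : (d_FPS alpha rr)%:E = e by [].
  by apply/le_anti; rewrite le_e FPS_outer (outer X).
have JD_tight : d_FPS alpha rr = d_JD alpha rr -> exists X : scheme R N,
    [/\ valid_scheme rr X, joint_ML alpha X
      & has_dmt G alpha X (d_FPS alpha rr)%:E].
  move=> eJD; have [X [e [vX mlX hX le_e]]] := JD; exists X; split=> //.
  by apply: tight hX _ => //; rewrite eJD.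
have HK_tight : alpha / 2 <= r -> exists2 c : hk_code R N,
    is_hk alpha rr s1 p1 c
    & has_dmt G alpha (hk_scheme c) (d_FPS alpha rr)%:E.
  move=> h; have hs1 : rate_split rr s1 by exact: rate_split_s1.
  have hp1 : power_split p1 by exact: power_split_p1.
  have [c [e [hc hX le_e]]] := HK _ _ hs1 hp1; exists c => //.
  case: (hc) => vX _ _ _ _; apply: tight hX _ => //.
  by rewrite d_FPS_large // d_HK_large // -(d_HK_at_s1_p1 a23).
have [X FX hX] : exists2 X : scheme R N, FPS_scheme alpha rr X
    & has_dmt G alpha X (d_FPS alpha rr)%:E.
  (* The split follows the selection rule rather than r: a tie selects joint decoding even when r >=
     alpha/2. *)
  case: (leP (d_HK alpha rr) (d_JD alpha rr)) => hle.
    have [|X [vX mlX hX]] := JD_tight; first exact: max_r.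
    by exists X => //; rewrite /FPS_scheme hle.
  have h : alpha / 2 <= r.
    by case: leP => // h; move: hle; rewrite ltNge d_HK_small.
  have [c hc hX] := HK_tight h; exists (hk_scheme c) => //.
  rewrite /FPS_scheme leNgt hle /=; exists s1, p1, c; split=> //.
  + exact: rate_split_s1.
  + exact: power_split_p1.
  + by rewrite d_HK_large // d_HK_at_s1_p1.
split=> //.
- split; last by rewrite FPS_outer.
  exists X => //; move: FX; rewrite /FPS_scheme; case: ifP => _; first by case.
  by case=> s [p [c [_ _ _ [vX _ _ _ _] ->]]].
- by exists X.
- by move=> h; apply: JD_tight; exact: d_FPS_small.
Qed.
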